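(* Let $0<q<1$, let $s\in\{0,\tfrac12,1,\tfrac32,\dots\}$, let $\ell\in\mathcal{J}_s$, and put $a=|s-\ell|$, $N=\min(2s,s+\ell)-|s-\ell|$. The diagonal matrix $S_1=\mathrm{diag}(\gamma_0,\gamma_1,\dots,\gamma_N)$ and the $(N+1)\times(N+1)$ matrix $S_2$ with entries $$(S_2)_{ij}=m_q\,\gamma_i^{-1}\gamma_j^{-1}\beta_j^2\,R_i\big(\mu(j);q^{2a},q^{2a},q^{2(3a+N+1)},q^{-2(a+N+1)}\,|\,q^2\big),\qquad i,j=0,1,\dots,N,$$ provide a representation of the braid group on three strands; that is, $S_1,S_2$ are invertible and $S_1S_2S_1=S_2S_1S_2$.
   Context: Throughout $0<q<1$. For $s\in\{0,\frac12,1,\frac32,\dots\}$, $\mathcal{J}_s=\{j_{\min},j_{\min}+1,\dots,3s\}$ with $j_{\min}=0$ if $s$ is an integer and $j_{\min}=\frac12$ if $s$ is a half-integer (not an integer). For $\ell\in\mathcal{J}_s$, $a=|s-\ell|$ and $N=\min(2s,s+\ell)-|s-\ell|$ are nonnegative integers. The braid group on three strands is generated by invertible elements $s_1,s_2$ subject to $s_1s_2s_1=s_2s_1s_2$. Notation. $(z;p)_0=1$, $(z;p)_k=\prod_{m=1}^k(1-zp^{m-1})$, $(z_1,\dots,z_r;p)_k=(z_1;p)_k\cdots(z_r;p)_k$. For $r,j\in\{0,\dots,N\}$, $$\gamma_r=(-1)^rq^{r(r+2a+1)},\qquad m_q=q^{2N(3a+N+2)}\frac{(q^{-2(a+N)};q^2)_N}{(q^{4(a+1)};q^2)_N},$$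 $$\beta_j^2=q^{-2j(2a+1)}\frac{(q^{2a+3},-q^{2a+3},q^{2(2a+1)},q^{2(3a+N+2)},q^{-2N};q^2)_j}{(q^2,q^{2a+1},-q^{2a+1},q^{-2(a+N)},q^{2(2a+N+2)};q^2)_j}.$$ The $q$-Racah polynomials appearing in the claim are the terminating ${}_4\phi_3$ series $$R_i\big(\mu(j);q^{2a},q^{2a},q^{2(3a+N+1)},q^{-2(a+N+1)}|q^2\big)=\sum_{k=0}^{\min(i,j)}\frac{(q^{-2i},q^{2(2a+1+i)},q^{-2j},q^{2(2a+1+j)};q^2)_k}{(q^{2(a+1)},q^{-2N},q^{2(3a+N+2)};q^2)_k}\frac{q^{2k}}{(q^2;q^2)_k}.$$ *)

(* Defs.v *)
From mathcomp Require Import all_boot all_order all_algebra.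
From mathcomp Require Import reals.
From mathcomp Require Import lra ring.
Set Implicit Arguments.
Unset Strict Implicit.
Unset Printing Implicit Defensive.
Import Order.TTheory GRing.Theory Num.Theory.
Local Open Scope ring_scope.

Definition is_spin (s : rat) : Prop := exists n : nat, s = n%:R / 2.

Definition jmin (s : rat) : rat := if s \is a Num.int then 0 else 1 / 2.

Definition Jset (s l : rat) : Prop :=
  exists k : nat, l = jmin s + k%:R /\ l <= 3 * s.

Lemma spin_params_nat (s l : rat) : is_spin s -> Jset s l ->
  exists a N : nat,
    a%:R = `|s - l| /\ N%:R = Num.min (2 * s) (s + l) - `|s - l|.
Proof.
move=> [n sE] [k [lE le3]].
have natI (m : nat) : (m%:R : rat) \is a Num.int by rewrite intr_nat.
have s2I : 2 * s \is a Num.int by rewrite sE mulrCA mulfV// mulr1.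
have s_ge0 : 0 <= s by rewrite sE divr_ge0.
have l_ge0 : 0 <= l by rewrite lE addr_ge0// /jmin; case: ifP.
have sI : s - jmin s \is a Num.int.
  rewrite /jmin; case: ifPn => [|sNint]; first by rewrite subr0.
  have nE : n%:R = (odd n)%:R + n./2%:R * 2 :> rat.
    by rewrite -{1}(odd_double_half n) natrD -mul2n natrM [2 * _]mulrC.
  case: (boolP (odd n)) nE => _ nE.
    have -> : s - 1 / 2 = n./2%:R by rewrite sE nE /= ?mulr1n ?mulr0n; field.
    exact: natI.
  suff : s \is a Num.int by rewrite (negPf sNint).
  have -> : s = n./2%:R by rewrite sE nE /= ?mulr1n ?mulr0n; field.
  exact: natI.
have slI : s - l \is a Num.int.
  have -> : s - l = s - jmin s - k%:R by rewrite lE; ring.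
  exact: rpredB.
have aN : `|s - l| \is a Num.nat by rewrite natr_norm_int.
have NN : Num.min (2 * s) (s + l) - `|s - l| \is a Num.nat.
  rewrite natrEint; apply/andP; split.
    apply: rpredB; last by rewrite intrEge0 ?normr_ge0.
    have slI' : s + l \is a Num.int.
      have -> : s + l = 2 * s - (s - l) by ring.
      exact: rpredB.
    by case: leP.
  by case: (ger0P (s - l)) => ?; case: (leP (2 * s)) => ?; lra.
move/natrP: aN => [a aE]; move/natrP: NN => [N NE].
by exists a, N; rewrite -aE -NE.
Qed.

Section BasicHypergeometric.
Variable R : realType.

Definition qpoch (z p : R) (k : nat) : R := \prod_(m < k) (1 - z * p ^+ m).

Definition qpochs (zs : seq R) (p : R) (k : nat) : R :=
  \prod_(z <- zs) qpoch z p k.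

(* The q-Racah polynomial R_n(mu(x); alpha, beta, gamma, delta | p), where
   mu(x) = p^(-x) + gamma delta p^(x+1), as a terminating 4phi3 series of
   base p; all its terms of index k > min(n, x) vanish. *)
Definition qRacah (alpha beta gamma delta p : R) (n x : nat) : R :=
  \sum_(k < (minn n x).+1)
    qpochs [:: p ^- n; alpha * beta * p ^+ n.+1;
               p ^- x; gamma * delta * p ^+ x.+1] p k
    / qpochs [:: alpha * p; beta * delta * p; gamma * p] p k
    * (p ^+ k / qpoch p p k).

End BasicHypergeometric.

Section BraidMatrices.
Variables (R : realType) (q : R) (a N : nat).

Definition gam (r : nat) : R := (-1) ^+ r * q ^+ (r * (r + 2 * a + 1)).

Definition mq : R :=
  q ^+ (2 * N * (3 * a + N + 2))
  * (qpoch (q ^- (2 * (a + N))) (q ^+ 2) N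
     / qpoch (q ^+ (4 * (a + 1))) (q ^+ 2) N).

(* beta_j^2; only this square occurs, so no square root is taken. *)
Definition beta2 (j : nat) : R :=
  q ^- (2 * j * (2 * a + 1))
  * (qpochs [:: q ^+ (2 * a + 3); - q ^+ (2 * a + 3); q ^+ (2 * (2 * a + 1));
                q ^+ (2 * (3 * a + N + 2)); q ^- (2 * N)] (q ^+ 2) j
     / qpochs [:: q ^+ 2; q ^+ (2 * a + 1); - q ^+ (2 * a + 1);
                  q ^- (2 * (a + N)); q ^+ (2 * (2 * a + N + 2))] (q ^+ 2) j).

Definition racah (i j : nat) : R :=
  qRacah (q ^+ (2 * a)) (q ^+ (2 * a)) (q ^+ (2 * (3 * a + N + 1)))
         (q ^- (2 * (a + N + 1))) (q ^+ 2) i j.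

Lemma racahE (i j : nat) : q != 0 ->
  racah i j =
  \sum_(k < (minn i j).+1)
    qpochs [:: q ^- (2 * i); q ^+ (2 * (2 * a + 1 + i));
               q ^- (2 * j); q ^+ (2 * (2 * a + 1 + j))] (q ^+ 2) k
    / qpochs [:: q ^+ (2 * (a + 1)); q ^- (2 * N);
                 q ^+ (2 * (3 * a + N + 2))] (q ^+ 2) k
    * (q ^+ (2 * k) / qpoch (q ^+ 2) (q ^+ 2) k).
Proof.
move=> q0; rewrite /racah /qRacah; apply: eq_bigr => k _.
have -> : q ^+ (2 * a) * q ^+ (2 * a) * (q ^+ 2) ^+ i.+1
          = q ^+ (2 * (2 * a + 1 + i)).
  by rewrite -exprM -!exprD; congr (_ ^+ _); ring.
have -> : q ^+ (2 * (3 * a + N + 1)) * q ^- (2 * (a + N + 1))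
          * (q ^+ 2) ^+ j.+1 = q ^+ (2 * (2 * a + 1 + j)).
  rewrite -exprM mulrAC -exprD -[RHS](mulfK (expf_neq0 (2 * (a + N + 1)) q0)).
  by rewrite -exprD; congr (_ ^+ _ / _); ring.
have -> : q ^+ (2 * a) * q ^- (2 * (a + N + 1)) * q ^+ 2 = q ^- (2 * N).
  rewrite mulrAC -exprD (_ : 2 * (a + N + 1) = 2 * a + 2 + 2 * N)%N; last by ring.
  by rewrite [in X in _ * X]exprD invfM mulrA mulfV ?mul1r ?expf_neq0.
by rewrite -!exprM -!exprD !(mulnDr 2) !muln1 -!addnA.
Qed.

Definition S1 : 'M[R]_N.+1 := diag_mx (\row_(r < N.+1) gam r).

Definition S2 : 'M[R]_N.+1 :=
  \matrix_(i < N.+1, j < N.+1)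
    (mq * (gam i)^-1 * (gam j)^-1 * beta2 j * racah i j).

End BraidMatrices.

(* Main.v *)
Require Import Defs.
From mathcomp Require Import all_boot all_order all_algebra.
From mathcomp Require Import reals.
From mathcomp Require Import ring zify.
Set Implicit Arguments.
Unset Strict Implicit.
Unset Printing Implicit Defensive.
Import Order.TTheory GRing.Theory Num.Theory.
Local Open Scope ring_scope.

(** Why the matrices satisfy the braid relation.

    With p = q^2 put d = p^(a+1), t = p^(2a+1), b = p^(3a+N+2), c = p^(-N), so
    that d^2 = p t and b c = t d.  After cancelling diagonal factors, the braid
    relation is one convolution identity for the q-Racah polynomials R_i(j):
      m_q sum_j R_i(j) omega_j R_k(j) = gamma_i gamma_k R_i(k),
    where omega_j = beta_j^2 / gamma_j.  By their definition the polynomials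
    have the symmetric expansion R_i(j) = sum_r D_r phi_r(i) phi_r(j), with
    phi_r(j) = (p^(-j), t p^j; p)_r.  In matrix form R = A D A^T with
    A_(i,r) = phi_r(i) lower triangular and invertible; in particular S_2 is
    invertible.  Write Gamma for the diagonal matrix of the gamma_i and Omega
    for that of the omega_j.  The convolution identity follows from two facts.

    - Multiplication by gamma_i acts on the basis phi_r by an explicit
      triangular matrix M, i.e. Gamma A = A M ([twist_phi]).  Its entries come
      from the q-Chu-Vandermonde sum, whose value reduces to gamma_i / gamma_k
      exactly because d^2 = p t.

    - The Gram matrix G = A^T Omega A satisfies m_q D G D = M D M^T.
      Entrywise ([gramE]), G_(r,s) is the total mass of omega times
      (b, c; p)_r (b, c; p)_s times a terminating 3phi2 in x = p^r, y = p^s.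

    Together they give m_q R Omega R = A M D M^T A^T = Gamma R Gamma, which is
    the claim ([qracah_conv], [racah_conv]).

    To compute G, note that phi_(r+1) = phi_r (1 + t p^(2r) - p^r lambda_j) for
    lambda_j = p^(-j) + t p^j.  Multiplication by lambda is self-adjoint for
    omega, and this gives a recurrence that determines column s + 1 of G from
    column s ([gram_sym]).  The 3phi2 obeys the same recurrence: it is a
    diagonal bilinear form in the polynomials newt_k(x) newt_k(y), and the
    relevant q-difference operator is tridiagonal on newt_k and symmetric for
    that form ([christoffel_darboux], [phi32_sym]).  The first column of G is
    a limiting case of the very-well-poised 6phi5 sum, summed here by
    telescoping ([moment]); the moment of order N has a single nonzero term,
    which yields the normalisation m_q = 1 / sum_j omega_j ([omega_sum]). *)

(** * Shifted factorials and the q-Chu-Vandermonde sum *)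

Section QPochhammer.
Variables (R : realType) (p : R).

Lemma qpoch0 (z : R) : qpoch z p 0 = 1.
Proof. by rewrite /qpoch big_ord0. Qed.

Lemma qpochS (z : R) k : qpoch z p k.+1 = qpoch z p k * (1 - z * p ^+ k).
Proof. by rewrite /qpoch big_ord_recr. Qed.

Lemma qpochD (z : R) m n :
  qpoch z p (m + n) = qpoch z p m * qpoch (z * p ^+ m) p n.
Proof.
elim: n => [|n IHn]; first by rewrite addn0 qpoch0 mulr1.
by rewrite addnS !qpochS IHn exprD !mulrA.
Qed.

Lemma qpochSl (z : R) k : qpoch z p k.+1 = (1 - z) * qpoch (z * p) p k.
Proof. by rewrite -add1n qpochD qpochS qpoch0 mul1r mulr1 expr1. Qed.

Lemma qpoch_shift (z : R) k :
  qpoch z p k * (1 - z * p ^+ k) = (1 - z) * qpoch (z * p) p k.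
Proof. by rewrite -qpochS qpochSl. Qed.

Lemma qpoch_neq0 (z : R) k :
  (forall m, (m < k)%N -> 1 - z * p ^+ m != 0) -> qpoch z p k != 0.
Proof. by move=> nz; apply/prodf_neq0 => m _; apply: nz. Qed.

Lemma qpoch_base_neq0 k : (forall m, 1 - p ^+ m.+1 != 0) -> qpoch p p k != 0.
Proof. by move=> p1; apply: qpoch_neq0 => m _; rewrite -exprS. Qed.

Lemma qpoch_vanish j k : p != 0 -> (j < k)%N -> qpoch (p ^- j) p k = 0.
Proof.
move=> p0 ltjk; apply/eqP/prodf_eq0; exists (Ordinal ltjk) => //=.
by rewrite mulVf ?subrr ?expf_neq0.
Qed.

(** In a very-well-poised series the four parameters w p, - w p over w, - w,
    with w a square root of t, collapse to this single quotient. *)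
Lemma qpoch_square (w : R) j : 1 - w != 0 -> 1 + w != 0 ->
  qpoch (w * p) p j * qpoch (- (w * p)) p j =
  qpoch w p j * qpoch (- w) p j * ((1 - w ^+ 2 * p ^+ (2 * j)) / (1 - w ^+ 2)).
Proof.
move=> w1 w2.
have := qpoch_shift (- w) j; have := qpoch_shift w j; rewrite mulNr => E1 E2.
have -> : qpoch (w * p) p j = qpoch w p j * (1 - w * p ^+ j) / (1 - w).
  by rewrite E1 mulrAC divff ?mul1r.
have -> : qpoch (- (w * p)) p j = qpoch (- w) p j * (1 + w * p ^+ j) / (1 + w).
  by move: E2; rewrite mulNr !opprK => ->; rewrite mulrAC divff ?mul1r.
have -> : 1 - w ^+ 2 = (1 - w) * (1 + w) by ring.
by rewrite mulnC (exprM p j 2); field; rewrite w1 w2.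
Qed.

Lemma expr_invS n : p != 0 -> p ^- n.+1 * p = p ^- n.
Proof. by move=> p0; rewrite exprS invfM mulrAC mulVf ?mul1r. Qed.

Lemma qpoch_negpow N : p != 0 ->
  qpoch (p ^- N) p N =
  (-1) ^+ N * p ^+ 'C(N, 2) * (p ^- N) ^+ N * qpoch p p N.
Proof.
move=> p0; elim: N => [|N IHN]; first by rewrite !qpoch0 !expr0 !mul1r.
have pN0 : p ^+ N != 0 by rewrite expf_neq0.
rewrite qpochSl [in RHS]qpochS.
have -> : p ^- N.+1 * p = p ^- N by exact: expr_invS.
rewrite IHN binS bin1 !exprVn -!exprM exprD.
have -> : (N.+1 * N.+1 = N * N + N + N + 1)%N by lia.
rewrite !exprS !exprD expr1.
have := expf_neq0 (N * N) p0; move: (p ^+ (N * N)) => y y0.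
by field; rewrite ?p0 ?pN0.
Qed.

(** Let S_n be the left-hand side.  It satisfies
    (1 - C p^n) S_(n+1) = (B - C p^n) S_n, because the corresponding combination
    of the r-th terms telescopes in r (the claim [tele] in the proof).
    The value is kept as a product over m so that B = 0 needs no separate
    treatment. *)
Lemma q_chu_vandermonde (B C : R) n :
    p != 0 -> (forall m, 1 - p ^+ m.+1 != 0) ->
    (forall m, 1 - C * p ^+ m != 0) ->
  \sum_(r < n.+1) qpoch (p ^- n) p r * qpoch B p r
     / (qpoch C p r * qpoch p p r) * p ^+ r
  = (\prod_(m < n) (B - C * p ^+ m)) / qpoch C p n.
Proof.
move=> p0 p1 C1.
have Cn k : qpoch C p k != 0 by apply: qpoch_neq0.
have pn k : qpoch p p k != 0 by exact: qpoch_base_neq0.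
elim: n => [|n IHn].
  by rewrite big_ord_recl !big_ord0 !qpoch0 !mul1r invr1 addr0 expr0 mulr1.
have tele k :
  \sum_(r < k.+1) ((1 - C * p ^+ n) *
      (qpoch (p ^- n.+1) p r * qpoch B p r
         / (qpoch C p r * qpoch p p r) * p ^+ r) -
     (B - C * p ^+ n) *
      (qpoch (p ^- n) p r * qpoch B p r
         / (qpoch C p r * qpoch p p r) * p ^+ r))
  = qpoch (p ^- n) p k * qpoch B p k.+1 / (qpoch C p k * qpoch p p k).
  elim: k => [|k IHk].
    rewrite big_ord_recl big_ord0 !qpochS !qpoch0 !expr0 !mulr1 !mul1r.
    by rewrite addr0 invr1; ring.
  rewrite big_ord_recr /= IHk.
  rewrite (qpochSl (p ^- n.+1)).
  have -> : p ^- n.+1 * p = p ^- n by exact: expr_invS.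
  rewrite !(qpochS _ k.+1) !(qpochS _ k) -?exprS.
  have := C1 k; have := p1 k; have := Cn k; have := pn k.
  rewrite !exprS.
  have := expf_neq0 n p0; have := expf_neq0 k p0.
  move: (p ^+ n) (p ^+ k) (qpoch _ p k) (qpoch B p k) (qpoch C p k)
    (qpoch p p k) => y x P1 P2 P3 P4 x0 y0 P40 P30 h1 h2.
  by field; rewrite ?P40 ?P30 ?x0 ?p0 ?y0 ?h1 ?h2.
have := tele n.+1; rewrite sumrB -!mulr_sumr qpoch_vanish // !mul0r.
rewrite [in X in _ - X]big_ord_recr /= qpoch_vanish // !mul0r addr0 IHn.
move/eqP; rewrite subr_eq0 => /eqP E; apply: (mulfI (C1 n)); rewrite E.
rewrite big_ord_recr qpochS /=.
by field; rewrite ?Cn ?C1.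
Qed.

(** * The two Newton bases and the action of the twist *)

Definition newt (k : nat) (x : R) : R := \prod_(m < k) (x - p ^+ m).

Lemma newtS k x : newt k.+1 x = newt k x * (x - p ^+ k).
Proof. by rewrite /newt big_ord_recr. Qed.

Lemma newt0 x : newt 0 x = 1.
Proof. by rewrite /newt big_ord0. Qed.

Lemma newt_vanish r k : (r < k)%N -> newt k (p ^+ r) = 0.
Proof.
by move=> lt; apply/eqP/prodf_eq0; exists (Ordinal lt); rewrite ?subrr.
Qed.

Lemma newtS_shift k x : newt k.+1 (p * x) = p ^+ k * (p * x - 1) * newt k x.
Proof.
elim: k => [|k IHk]; first by rewrite newtS !newt0 expr0; ring.
by rewrite newtS IHk newtS !exprS; ring.
Qed.

(** At the node p^(k + r), a Newton polynomial is a quotient of shifted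
    factorials; this turns sums over r >= k into basic hypergeometric ones. *)
Lemma newt_expD k r : (forall m, 1 - p ^+ m.+1 != 0) ->
  newt k (p ^+ (k + r)) =
  (-1) ^+ k * p ^+ 'C(k, 2) * (qpoch p p (k + r) / qpoch p p r).
Proof.
move=> p1; have pn j : qpoch p p j != 0 by exact: qpoch_base_neq0.
elim: k r => [|k IHk] r; first by rewrite newt0 !expr0 !mul1r divff.
rewrite newtS addSnnS IHk (qpochS _ r) binS bin1 -exprS !exprD !exprS.
by field; rewrite ?pn -?exprS ?p1.
Qed.

(** As a function of j, this is a polynomial of degree r in
    p^(-j) + t p^j, vanishing for j < r. *)
Definition phi (t : R) (r j : nat) : R :=
  qpoch (p ^- j) p r * qpoch (t * p ^+ j) p r.

Lemma phi_vanish t r j : p != 0 -> (j < r)%N -> phi t r j = 0.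
Proof. by move=> p0 lt; rewrite /phi qpoch_vanish ?mul0r. Qed.

(** With d = p^(a+1) and p = q^2 these are the eigenvalues gamma_i. *)
Definition twist (d : R) (i : nat) : R := (- d) ^+ i * p ^+ 'C(i, 2).

(** The numerator product of the q-Chu-Vandermonde sum at B = t p^n, C = d.
    Since t / d = d / p, reversing the order of the factors reproduces (d; p)_n,
    which then cancels the denominator of that sum. *)
Lemma twist_prod (t d : R) n : d ^+ 2 = p * t -> p != 0 -> d != 0 ->
  \prod_(m < n) (t * p ^+ n - d * p ^+ m) = twist d n * qpoch d p n.
Proof.
move=> dd p0 d0; have tE : t = d ^+ 2 / p by rewrite dd mulrAC divff ?mul1r.
have -> : qpoch d p n = \prod_(m < n) (1 - d * p ^+ (n - m.+1)).
  by rewrite /qpoch (reindex_inj rev_ord_inj).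
have -> : twist d n = \prod_(m < n) (- d * p ^+ m).
  rewrite /twist; elim: n => [|n IHn]; first by rewrite big_ord0 !expr0 mul1r.
  by rewrite big_ord_recr /= -IHn binS bin1 exprD exprS; ring.
rewrite -big_split; apply: eq_bigr => m _ /=.
rewrite tE -{1}(subnKC (ltn_ord m)) exprD (exprS p m).
by field.
Qed.

Lemma sum_widen (F : nat -> R) n N : (n <= N)%N ->
    (forall r, (n < r)%N -> F r = 0) ->
  \sum_(r < N.+1) F r = \sum_(r < n.+1) F r.
Proof.
move=> leN F0; rewrite -(subnKC leN) -addSn big_split_ord /=.
by rewrite [X in _ + X]big1 ?addr0 // => r _; rewrite F0 ?leq_addr.
Qed.

Lemma bin2D k n : 'C(k + n, 2) = ('C(k, 2) + 'C(n, 2) + k * n)%N.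
Proof.
elim: k => [|k IHk]; first by rewrite add0n addn0.
by rewrite addSn !binS !bin1 IHk; lia.
Qed.

(** Multiplication by the twist is triangular in the basis phi_r: reading the
    identity from right to left expands twist_i phi_k(i) in the phi_r(i).
    The terms r < k vanish because of newt_k, and the substitution r = k + r'
    leaves the q-Chu-Vandermonde sum with t, d replaced by t p^(2k), d p^k, a
    change that preserves d^2 = p t. *)
Lemma twist_phi (t d : R) k i N :
    p != 0 -> (forall m, 1 - p ^+ m.+1 != 0) ->
    (forall m, 1 - d * p ^+ m != 0) -> d != 0 -> d ^+ 2 = p * t ->
    (i <= N)%N ->
  \sum_(r < N.+1) phi t r i * (p ^+ r / (qpoch d p r * qpoch p p r))
                  * newt k (p ^+ r)
  = twist d i * phi t k i / (qpoch d p k * (d / p) ^+ k).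
Proof.
move=> p0 p1 d1 d0 dd leiN.
rewrite (@sum_widen (fun r => phi t r i *
  (p ^+ r / (qpoch d p r * qpoch p p r)) * newt k (p ^+ r)) i) //; last first.
  by move=> r lt; rewrite phi_vanish ?mul0r.
have [ltik|leki] := ltnP i k.
  rewrite big1 => [|r _]; first by rewrite phi_vanish // mulr0 mul0r.
  by rewrite newt_vanish ?mulr0 // (leq_trans (ltn_ord r)).
rewrite -(subnKC leki); move: (i - k)%N => n {i leiN leki}.
rewrite -addnS big_split_ord /= big1 ?add0r => [|r _]; last first.
  by rewrite newt_vanish ?mulr0.
have pn j : qpoch p p j != 0 by exact: qpoch_base_neq0.
have dn j : qpoch d p j != 0 by exact: qpoch_neq0.
have dk1 m : 1 - d * p ^+ k * p ^+ m != 0 by rewrite -mulrA -exprD.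
have dkn j : qpoch (d * p ^+ k) p j != 0 by exact: qpoch_neq0.
have pk0 := expf_neq0 k p0.
transitivity (phi t k (k + n) * p ^+ k / qpoch d p k * (-1) ^+ k * p ^+ 'C(k, 2)
  * \sum_(r < n.+1) qpoch (p ^- n) p r * qpoch (t * p ^+ (2 * k) * p ^+ n) p r
     / (qpoch (d * p ^+ k) p r * qpoch p p r) * p ^+ r).
  rewrite mulr_sumr; apply: eq_bigr => r _.
  rewrite newt_expD // {1}/phi !qpochD /phi.
  have -> : p ^- (k + n) * p ^+ k = p ^- n.
    by rewrite exprD; field; rewrite pk0 expf_neq0.
  have -> : t * p ^+ (k + n) * p ^+ k = t * p ^+ (2 * k) * p ^+ n.
    by rewrite mul2n -addnn !exprD; ring.
  rewrite (exprD p k r).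
  have := pn k; have := pn (k + r)%N; rewrite qpochD mulf_eq0.
  case/norP => h1 h2 h3.
  by field; rewrite ?dn ?dkn ?pn ?h1 ?h2.
rewrite q_chu_vandermonde //.
rewrite twist_prod ?mulf_neq0 //; last first.
  by rewrite exprMn dd mul2n -addnn exprD; ring.
rewrite mulfK //.
have -> : twist d (k + n) =
    twist d k * twist (d * p ^+ k) n.
  by rewrite /twist bin2D !exprD exprM -mulNr exprMn; ring.
rewrite {2}/twist expr_div_n (exprNn d).
have dk0 := expf_neq0 k d0.
by field; rewrite ?dk0 ?pk0 ?dn.
Qed.

(** * A symmetric 3phi2 kernel *)

Section ChristoffelDarboux.
Variables (t b c d : R).

(** Since newt_k(p^r) = (p^(-r); p)_k p^(rk), the form
    sum_k phi32_coef k newt_k(p^r) newt_k(p^s) is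
    3phi2(p^(-r), p^(-s), d; b, c; p, t p^(r+s)). *)
Definition phi32_coef k := qpoch d p k * t ^+ k
  / (qpoch c p k * qpoch b p k * qpoch p p k).

(** The value on newt_k of the operator taking f to
    ((1 + t x^2) f(x) - (1 - c x)(1 - b x) f(p x)) / x. *)
Definition qdiff k (x : R) := ((1 + t * x ^+ 2) * newt k x
  - (1 - c * x) * (1 - b * x) * newt k (p * x)) / x.

(** The operator of [qdiff] is tridiagonal on the Newton basis: with z = p^k it
    sends newt_k to
      (t - b c z) newt_(k+1) + v_k newt_k
        + (1 - c z / p)(1 - b z / p)(1 - z) newt_(k-1).
    The ratio of consecutive coefficients of the kernel is exactly what makes
    the two off-diagonal parts adjoint, so that in the antisymmetrised sum only
    a boundary term survives. *)
Lemma christoffel_darboux n (x y : R) :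
    p != 0 -> (forall m, 1 - p ^+ m.+1 != 0) ->
    (forall m, 1 - b * p ^+ m != 0) ->
    (forall m, (m < n)%N -> 1 - c * p ^+ m != 0) ->
    b * c = t * d -> x != 0 -> y != 0 ->
  \sum_(k < n.+1) phi32_coef k * (qdiff k x * newt k y - newt k x * qdiff k y)
  = phi32_coef n * (t - b * c * p ^+ n)
    * (newt n.+1 x * newt n y - newt n x * newt n.+1 y).
Proof.
move=> p0 p1 b1 + bc x0 y0; elim: n => [|n IHn] c1.
  rewrite big_ord_recl big_ord0 /qdiff !newtS !newt0 expr0.
  by field; rewrite ?x0 ?y0.
rewrite big_ord_recr /= IHn => [|m lt]; last by rewrite c1 ?ltnS ?(ltnW lt).
have pn j : qpoch p p j != 0 by exact: qpoch_base_neq0.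
have bn j : qpoch b p j != 0 by exact: qpoch_neq0.
have cn : qpoch c p n != 0.
  by apply: qpoch_neq0 => m lt; rewrite c1 // ltnS ltnW.
have z0 := expf_neq0 n p0.
have -> : phi32_coef n.+1 = phi32_coef n * (t - b * c * p ^+ n) /
   ((1 - c * p ^+ n) * (1 - b * p ^+ n) * (1 - p ^+ n.+1)).
  rewrite /phi32_coef !qpochS bc !exprS.
  by field; rewrite -!exprS ?pn ?bn ?cn ?b1 ?p1 ?c1.
move: (phi32_coef n) => e; rewrite /qdiff !newtS_shift !newtS.
have := c1 n (ltnSn n); have := b1 n; have := p1 n; rewrite !exprS.
move: (newt n x) (newt n y) (p ^+ n) z0 => X Y z z0 h1 h2 h3.
by field; rewrite ?x0 ?y0 ?h1 ?h2 ?h3.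
Qed.
End ChristoffelDarboux.

(** * Moments and Gram matrix of the weight *)

Section Weight.
Variables (t b c : R).

(** Limit, as the third free parameter tends to 0, of the weight in the
    very-well-poised 6phi5 series with leading parameter t and free parameters
    b and c. *)
Definition omega j :=
  qpoch t p j * qpoch b p j * qpoch c p j
    / (qpoch p p j * qpoch (p * t / b) p j * qpoch (p * t / c) p j)
  * ((1 - t * p ^+ (2 * j)) / (1 - t))
  * ((- (b * c)) ^- j * p ^- 'C(j, 2)).

Lemma phi_shift r n : p != 0 ->
  phi t r n * ((1 - p ^- n.+1) * (1 - t * p ^+ r * p ^+ n)) =
  phi t r n.+1 * ((1 - p ^+ r / p ^+ n.+1) * (1 - t * p ^+ n)).
Proof.
move=> p0.
have := qpoch_shift (p ^- n.+1) r; have := qpoch_shift (t * p ^+ n) r.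
have -> : p ^- n.+1 * p = p ^- n by exact: expr_invS.
have -> : t * p ^+ n * p = t * p ^+ n.+1 by rewrite exprS; ring.
rewrite /phi => E1 E2.
transitivity ((1 - p ^- n.+1) * qpoch (p ^- n) p r *
  (qpoch (t * p ^+ n) p r * (1 - t * p ^+ n * p ^+ r))); first by ring.
by rewrite E1 -E2; ring.
Qed.

(** Indefinite summation in j: the partial sums up to n are a rational multiple
    of phi_r(n) omega_n.  The factor 1 - c p^n makes the full sum up to N vanish
    when c = p^(-N). *)
Lemma moment_partial_sum r n :
    p != 0 -> (forall m, 1 - p ^+ m.+1 != 0) ->
    (forall m, 1 - t * p ^+ m != 0) ->
    (forall m, (m < n)%N -> 1 - p * t / b * p ^+ m != 0) ->
    (forall m, (m < n)%N -> 1 - p * t / c * p ^+ m != 0) ->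
    b != 0 -> c != 0 ->
  \sum_(j < n.+1)
    (phi t r.+1 j - (1 - c * p ^+ r) * (1 - b * p ^+ r) * phi t r j) * omega j
  = - (p ^+ r * (1 - b * p ^+ n) * (1 - c * p ^+ n) * (1 - t * p ^+ r * p ^+ n)
      / ((1 - t * p ^+ (2 * n)) * p ^+ n) * phi t r n * omega n).
Proof.
move=> p0 p1 t1 + + b0 c0; elim: n => [|n IHn] hb hc.
  rewrite big_ord_recl big_ord0 muln0 expr0 addr0.
  have := t1 0; rewrite expr0 mulr1 => h.
  case: r => [|r]; last first.
    by rewrite !phi_vanish // ?mulr0 ?mul0r ?subr0 ?oppr0 ?mul0r.
  rewrite (phi_vanish _ p0 (isT : (0 < 1)%N)) expr0.
  by field; rewrite ?h.
rewrite big_ord_recr /= IHn => [|m lt|m lt]; last 2 first.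
- by rewrite hb // ltnS ltnW.
- by rewrite hc // ltnS ltnW.
have z0 := expf_neq0 n p0.
have h1 : 1 - p ^- n.+1 != 0.
  apply: contraNneq (p1 n) => /eqP; rewrite subr_eq0 => /eqP E.
  by rewrite -[p ^+ n.+1]invrK -E invr1 subrr.
have h2 : 1 - t * p ^+ r * p ^+ n != 0 by rewrite -mulrA -exprD.
(* phi_r(n) is written through phi_r(n + 1), not the other way round: the
   factor 1 - p^r / p^(n+1) is zero at r = n + 1. *)
have -> : phi t r n = phi t r n.+1 *
   ((1 - p ^+ r / p ^+ n.+1) * (1 - t * p ^+ n))
    / ((1 - p ^- n.+1) * (1 - t * p ^+ r * p ^+ n)).
  by rewrite -phi_shift // mulfK // mulf_neq0.
have pn j : qpoch p p j != 0 by exact: qpoch_base_neq0.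
have bn : qpoch (p * t / b) p n != 0.
  by apply: qpoch_neq0 => m lt; rewrite hb // ltnS ltnW.
have cn : qpoch (p * t / c) p n != 0.
  by apply: qpoch_neq0 => m lt; rewrite hc // ltnS ltnW.
have kb : b - p * t * p ^+ n != 0.
  apply: contraNneq (hb n (ltnSn n)) => E.
  have -> : 1 - p * t / b * p ^+ n = (b - p * t * p ^+ n) / b by field.
  by rewrite E mul0r.
have kc : c - p * t * p ^+ n != 0.
  apply: contraNneq (hc n (ltnSn n)) => E.
  have -> : 1 - p * t / c * p ^+ n = (c - p * t * p ^+ n) / c by field.
  by rewrite E mul0r.
have pos : 1 - t * p ^+ (2 * n) != 0 by [].
have pos2 : 1 - t * p ^+ (2 * n.+1) != 0 by [].
have -> : omega n.+1 = omega n * (1 - t * p ^+ n) * (1 - b * p ^+ n)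
   * (1 - c * p ^+ n) * (1 - t * p ^+ (2 * n.+1)) / ((1 - p ^+ n.+1) *
   (1 - p * t / b * p ^+ n) * (1 - p * t / c * p ^+ n) * (1 - t * p ^+ (2 * n)))
   / (- (b * c) * p ^+ n).
  rewrite /omega !qpochS binS bin1 exprD -(exprS p n) (exprS (- (b * c)) n).
  have := t1 0%N; rewrite expr0 mulr1 => t1'.
  have bcn : (- (b * c)) ^+ n != 0 by rewrite expf_neq0 ?oppr_eq0 ?mulf_neq0.
  have := expf_neq0 'C(n, 2) p0; have := hb n (ltnSn n); have := hc n (ltnSn n).
  have := p1 n; have := bcn; have := pn n.
  have := pos; have := pos2; have := bn; have := cn; have := t1'.
  move: (p ^+ 'C(n,2)) (p ^+ n.+1) ((- (b * c)) ^+ n) (qpoch p p n)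
    (qpoch (p * t / b) p n) (qpoch (p * t / c) p n)
    (p ^+ (2 * n)) (p ^+ (2 * n.+1)) => A1 A2 A3 A4 A5 A6 A7 A8.
  move=> i1 i2 i3 i4 i5 i6 i7 i8 i9 i10 i11.
  by field; rewrite ?c0 ?b0 ?i1 ?i2 ?i3 ?i4 ?i5 ?i6 ?i7 ?i8 ?i11 ?kb ?kc ?z0.
have -> : phi t r.+1 n.+1 = phi t r n.+1 *
    ((1 - p ^+ r / p ^+ n.+1) * (1 - t * p ^+ n.+1 * p ^+ r)).
  by rewrite /phi !qpochS [p ^+ r / _]mulrC; ring.
have := pos; have := pos2; have := p1 n.
have -> : p ^+ (2 * n.+1) = p ^+ 2 * p ^+ n ^+ 2.
  by rewrite mulnC exprM -exprMn -exprS.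
have -> : p ^+ (2 * n) = p ^+ n ^+ 2 by rewrite mulnC exprM.
rewrite (exprS p n) => i1 i2 i3.
move: (phi t r n.+1) (omega n) h2 => P O h2.
have i4 : p * p ^+ n - 1 != 0 by rewrite -opprB oppr_eq0.
move: (p ^+ n) (p ^+ r) z0 h2 kb kc i1 i2 i3 i4 => z x z0 h2 kb kc i1 i2 i3 i4.
by field; rewrite ?z0 ?c0 ?b0 ?i1 ?i2 ?i3 ?i4 ?kb ?kc ?p0 ?h2 exprMn ?i2.
Qed.

Lemma phiS r j : phi t r.+1 j =
  phi t r j * ((1 - p ^- j * p ^+ r) * (1 - t * p ^+ j * p ^+ r)).
Proof. by rewrite /phi !qpochS; ring. Qed.

Variables (d : R) (N : nat).
Hypotheses (p0 : p != 0) (p1 : forall m, 1 - p ^+ m.+1 != 0).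
Hypothesis (t1 : forall m, 1 - t * p ^+ m != 0).
Hypotheses (b0 : b != 0) (b1 : forall m, 1 - b * p ^+ m != 0).
Hypothesis (d0 : d != 0) (d1 : forall m, 1 - d * p ^+ m != 0).
Hypothesis (cE : c = p ^- N).
Hypothesis (tb1 : forall m, (m < N)%N -> 1 - p * t / b * p ^+ m != 0).
Hypotheses (dd : d ^+ 2 = p * t) (bc : b * c = t * d).

Let c0 : c != 0. Proof. by rewrite cE invr_eq0 expf_neq0. Qed.

Let c1 m : (m < N)%N -> 1 - c * p ^+ m != 0.
Proof.
move=> lt; apply: contraNneq (p1 (N - m.+1)%N) => E.
have <- : (1 - c * p ^+ m) * - p ^+ (N - m.+1).+1 = 1 - p ^+ (N - m.+1).+1.
  rewrite -subSn // subSS cE -[in p ^- N](subnK (ltnW lt)) exprD.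
  by field; rewrite !expf_neq0.
by rewrite E mul0r.
Qed.

Let tc1 m : 1 - p * t / c * p ^+ m != 0.
Proof.
rewrite cE invrK (_ : p * t * p ^+ N * p ^+ m = t * p ^+ (N + m).+1) //.
by rewrite exprS exprD; ring.
Qed.

Let pn k : qpoch p p k != 0. Proof. exact: qpoch_base_neq0. Qed.
Let dn k : qpoch d p k != 0. Proof. exact: qpoch_neq0. Qed.
Let bn k : qpoch b p k != 0. Proof. exact: qpoch_neq0. Qed.
Let cn k : (k <= N)%N -> qpoch c p k != 0.
Proof.
by move=> le; apply: qpoch_neq0 => m lt; rewrite c1 // (leq_trans lt).
Qed.

Lemma moment r : \sum_(j < N.+1) phi t r j * omega j =
  qpoch c p r * qpoch b p r * \sum_(j < N.+1) omega j.
Proof.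
elim: r => [|r IHr].
  by rewrite !qpoch0 !mul1r; apply: eq_bigr => j _; rewrite /phi !qpoch0 !mul1r.
have := @moment_partial_sum r N p0 p1 t1 tb1 (fun m _ => tc1 m) b0 c0.
rewrite {2}cE mulVf ?expf_neq0 // subrr mulr0 !mul0r oppr0.
under eq_bigr do rewrite mulrBl -mulrA.
rewrite sumrB -mulr_sumr => /eqP; rewrite subr_eq0 => /eqP ->.
by rewrite IHr !qpochS; ring.
Qed.

Definition gram r s := \sum_(j < N.+1) phi t r j * phi t s j * omega j.

(** Both sides are the Gram entry with the extra factor p^(-j) + t p^j, obtained
    from phi_r on the left and from phi_s on the right. *)
Lemma gram_sym r s :
  ((1 + t * p ^+ r ^+ 2) * gram r s - gram r.+1 s) / p ^+ r =
  ((1 + t * p ^+ s ^+ 2) * gram r s - gram r s.+1) / p ^+ s.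
Proof.
have rn := expf_neq0 r p0; have sn := expf_neq0 s p0.
rewrite /gram !mulr_sumr -!sumrB !mulr_suml; apply: eq_bigr => j _.
have jn := expf_neq0 j p0.
by rewrite !phiS; field; rewrite ?rn ?sn ?jn.
Qed.

Definition phi32 (x y : R) :=
  \sum_(k < N.+1) phi32_coef t b c d k * newt k x * newt k y.

(** Christoffel-Darboux at x = p^r, y = p^s: the boundary term contains
    newt_(N+1), which vanishes at both points. *)
Lemma phi32_sym r s : (r <= N)%N -> (s <= N)%N ->
  let x := p ^+ r in let y := p ^+ s in
  ((1 + t * x ^+ 2) * phi32 x y
    - (1 - c * x) * (1 - b * x) * phi32 (p ^+ r.+1) y) / x =
  ((1 + t * y ^+ 2) * phi32 x y
    - (1 - c * y) * (1 - b * y) * phi32 x (p ^+ s.+1)) / y.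
Proof.
move=> ler les x y.
have := christoffel_darboux p0 p1 b1 c1 bc (expf_neq0 r p0) (expf_neq0 s p0).
rewrite (@newt_vanish r N.+1) // (@newt_vanish s N.+1) //.
rewrite mul0r mulr0 subrr mulr0 => E.
apply/eqP; rewrite -subr_eq0 -E; apply/eqP.
rewrite /phi32 !mulr_sumr -!sumrB !mulr_suml -sumrB; apply: eq_bigr => k _.
by rewrite /qdiff -!exprS /x /y; ring.
Qed.

(** Both sides satisfy the recurrence that produces column s + 1 from column s,
    by [gram_sym] and [phi32_sym], and they agree at s = 0 by [moment], the
    kernel being 1 at y = 1. *)
Lemma gramE r s : (r <= N)%N -> (s <= N)%N ->
  gram r s = (\sum_(j < N.+1) omega j) * (qpoch c p r * qpoch b p r)
    * (qpoch c p s * qpoch b p s) * phi32 (p ^+ r) (p ^+ s).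
Proof.
move=> + les; elim: s les r => [|s IHs] les r ler.
  have -> : phi32 (p ^+ r) (p ^+ 0) = 1.
    rewrite /phi32 big_ord_recl big1 => [|k _]; last first.
      by rewrite (@newt_vanish 0) ?mulr0.
    by rewrite /phi32_coef !newt0 !qpoch0 !mulr1 divr1 addr0.
  rewrite !qpoch0 !mulr1 mulrC -moment; apply: eq_bigr => j _.
  by rewrite /phi !qpoch0 !mulr1.
(* The recurrence at r = N calls for row N + 1, where both sides are zero:
   phi_(N+1) vanishes on 0..N and (c; p)_(N+1) = 0. *)
have {}IHs r' : (r' <= N.+1)%N -> gram r' s = (\sum_(j < N.+1) omega j)
   * (qpoch c p r' * qpoch b p r')
    * (qpoch c p s * qpoch b p s) * phi32 (p ^+ r') (p ^+ s).
  rewrite leq_eqVlt => /orP[/eqP -> | lt]; last by rewrite IHs // ltnW.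
  rewrite cE qpoch_vanish // !mul0r mulr0 !mul0r /gram big1 // => j _.
  by rewrite phi_vanish ?mul0r.
have rn := expf_neq0 r p0; have sn := expf_neq0 s p0.
have := gram_sym r s; have := phi32_sym ler (ltnW les).
rewrite (IHs r) ?(leq_trans ler) // (IHs r.+1) //= !qpochS.
move: (phi32 _ _) (phi32 _ _) (phi32 _ _) => h1 h2 h3.
move: (gram _ _) => g.
set K := \sum_(j < _) _; move: K (qpoch c p r) (qpoch b p r) (qpoch c p s)
  (qpoch b p s) => K Q1 Q2 Q3 Q4 E1 E2.
apply: oppr_inj.
apply: (addrI ((1 + t * p ^+ s ^+ 2) * (K * (Q1 * Q2) * (Q3 * Q4) * h3))).
apply: (mulIf (invr_neq0 sn)); rewrite -E2.
transitivity (K * (Q1 * Q2) * (Q3 * Q4) * (((1 + t * p ^+ r ^+ 2) * h3 -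
  (1 - c * p ^+ r) * (1 - b * p ^+ r) * h2) / p ^+ r)); first by ring.
by rewrite E1; ring.
Qed.

Definition racah_coef r := p ^+ r /
  (qpoch d p r * qpoch c p r * qpoch b p r * qpoch p p r).

Definition qracah i j := \sum_(r < N.+1) racah_coef r * phi t r i * phi t r j.

(** Expanding both polynomials in the phi_r produces the Gram matrix; its 3phi2
    kernel separates the variables r and s, and each of the two resulting sums
    is evaluated by [twist_phi].  The relation t = d^2 / p turns the leftover
    coefficients back into those of the q-Racah polynomial. *)
Lemma qracah_conv i k : (i <= N)%N -> (k <= N)%N ->
  \sum_(j < N.+1) qracah i j * omega j * qracah j k =
  (\sum_(j < N.+1) omega j) * (twist d i * twist d k * qracah i k).
Proof.
move=> lei lek; set G := \sum_(j < _) omega j.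
transitivity (\sum_(r < N.+1) \sum_(s < N.+1)
   racah_coef r * phi t r i * (racah_coef s * phi t s k) * gram r s).
  under eq_bigr do rewrite /qracah !mulr_suml.
  rewrite exchange_big; apply: eq_bigr => r _ /=.
  under eq_bigr do rewrite mulr_sumr.
  rewrite exchange_big; apply: eq_bigr => s _ /=.
  by rewrite /gram mulr_sumr; apply: eq_bigr => j _; ring.
transitivity (G * \sum_(l < N.+1) phi32_coef t b c d l *
  ((\sum_(r < N.+1) phi t r i * (p ^+ r / (qpoch d p r * qpoch p p r))
                     * newt l (p ^+ r)) *
   (\sum_(r < N.+1) phi t r k * (p ^+ r / (qpoch d p r * qpoch p p r))
                     * newt l (p ^+ r)))).
  rewrite mulr_sumr.
  transitivity (\sum_(r < N.+1) \sum_(l < N.+1) \sum_(s < N.+1)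
    G * (phi32_coef t b c d l *
     (phi t r i * (p ^+ r / (qpoch d p r * qpoch p p r)) * newt l (p ^+ r) *
     (phi t s k * (p ^+ s / (qpoch d p s * qpoch p p s)) * newt l (p ^+ s)))));
    last first.
    rewrite exchange_big; apply: eq_bigr => l _ /=.
    rewrite big_distrlr /= !mulr_sumr; apply: eq_bigr => r _.
    by rewrite !mulr_sumr.
  apply: eq_bigr => r _; rewrite exchange_big; apply: eq_bigr => s _ /=.
  have ler : (r <= N)%N := ltn_ord r; have les : (s <= N)%N := ltn_ord s.
  rewrite gramE // /phi32 -/G !mulr_sumr; apply: eq_bigr => l _.
  rewrite /racah_coef; move: (phi32_coef _ _ _ _ _) => e.
  by field; rewrite ?dn ?pn ?bn ?cn.
congr (_ * _); rewrite /qracah mulr_sumr; apply: eq_bigr => l _.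
have lel : (l <= N)%N := ltn_ord l.
rewrite !(@twist_phi t d) // /racah_coef /phi32_coef exprMn exprVn.
have -> : t ^+ l = d ^+ l ^+ 2 / p ^+ l.
  by rewrite -exprM mulnC exprM dd exprMn mulrAC divff ?mul1r ?expf_neq0.
have dl := expf_neq0 l d0; have pl := expf_neq0 l p0.
by field; rewrite ?dn ?pn ?bn ?cn ?dl ?pl.
Qed.

(** The moment of order N reduces to its last term, as phi_N vanishes on
    0..N-1; dividing it by (b, c; p)_N gives the total mass. *)
Lemma omega_sum : b ^+ N * (qpoch (p * t / b) p N / qpoch (p * t) p N)
   * \sum_(j < N.+1) omega j = 1.
Proof.
have := moment N; rewrite big_ord_recr /= big1 ?add0r => [E|j _]; last first.
  by rewrite phi_vanish ?mul0r.
have cbn : qpoch c p N * qpoch b p N != 0 by rewrite mulf_neq0 ?cn.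
apply: (mulfI cbn); rewrite mulr1 mulrCA -E.
rewrite /omega /phi -cE.
have ptn : qpoch (p * t) p N != 0.
  by apply: qpoch_neq0 => m _; rewrite [p * t]mulrC -mulrA -exprS.
have tbn : qpoch (p * t / b) p N != 0 by apply: qpoch_neq0.
have tcn : qpoch (p * t / c) p N != 0 by apply: qpoch_neq0.
have E1 : qpoch (t * p ^+ N) p N * (1 - t * p ^+ (2 * N)) =
    (1 - t * p ^+ N) * qpoch (p * t / c) p N.
  rewrite cE invrK mul2n -addnn exprD mulrA -qpochS qpochSl.
  by congr (_ * qpoch _ _ _); ring.
have E2 : qpoch t p N * (1 - t * p ^+ N) = (1 - t) * qpoch (p * t) p N.
  by rewrite -qpochS qpochSl [t * p]mulrC.
have t0 : 1 - t != 0 by have := t1 0; rewrite mulr1.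
have pN := expf_neq0 N p0; have pC := expf_neq0 'C(N, 2) p0.
have E3 : qpoch c p N = (-1) ^+ N * p ^+ 'C(N, 2) * c ^+ N * qpoch p p N.
  by rewrite cE qpoch_negpow.
have bN := expf_neq0 N b0; have cN := expf_neq0 N c0.
have -> : (- (b * c)) ^+ N = (-1) ^+ N * b ^+ N * c ^+ N.
  by rewrite (exprNn (b * c)) (exprMn N b) mulrA.
have sg : (-1) ^+ N != 0 :> R by rewrite signr_eq0.
transitivity (qpoch c p N * qpoch b p N * (
    qpoch (t * p ^+ N) p N * (1 - t * p ^+ (2 * N)) * qpoch t p N * qpoch c p N
    / ((-1) ^+ N * c ^+ N * p ^+ 'C(N, 2) * qpoch (p * t) p N * qpoch p p N
       * qpoch (p * t / c) p N * (1 - t)))).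
  by field; rewrite ?t0 ?ptn ?tbn ?tcn ?pn ?bN ?cN ?pC ?sg.
have -> : qpoch (t * p ^+ N) p N * (1 - t * p ^+ (2 * N)) * qpoch t p N =
    (1 - t) * qpoch (p * t) p N * qpoch (p * t / c) p N.
  by rewrite E1 mulrAC [_ * qpoch t p N]mulrC E2.
rewrite -[RHS]mulr1; congr (_ * _); rewrite E3.
by field; rewrite ?t0 ?ptn ?tbn ?tcn ?pn ?bN ?cN ?pC ?sg.
Qed.
End Weight.
End QPochhammer.

(** * The braid matrices *)

Section Braid.
Variables (R : realType) (q : R) (a N : nat).
Hypotheses (hq0 : 0 < q) (hq1 : q < 1).

Local Notation p := (q ^+ 2).
Local Notation d := (q ^+ (2 * (a + 1))).
Local Notation t := (q ^+ (2 * (2 * a + 1))).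
Local Notation b := (q ^+ (2 * (3 * a + N + 2))).
Local Notation c := (p ^- N).

Let q0 : q != 0. Proof. by rewrite gt_eqF. Qed.
Let qn n : q ^+ n != 0. Proof. exact: expf_neq0. Qed.

Let q1 n : 1 - q ^+ n.+1 != 0.
Proof. by rewrite gt_eqF // subr_gt0 exprn_ilt1 // ltW. Qed.

Let qp1 n m : (0 < n)%N -> 1 - q ^+ n * p ^+ m != 0.
Proof. by case: n => // n _; rewrite -exprM -exprD addSn. Qed.

Let q1V n m : (m < n)%N -> 1 - q ^- (2 * n) * p ^+ m != 0.
Proof.
move=> lt; rewrite -exprM -(subnK (ltnW lt)) mulnDr exprD invfM -mulrA mulVf //.
rewrite mulr1 (_ : 2 * (n - m) = (2 * (n - m)).-1.+1)%N; last by lia.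
apply: contraNneq (q1 (2 * (n - m)).-1) => /eqP; rewrite subr_eq0 => /eqP E.
by rewrite -[q ^+ _]invrK -E invr1 subrr.
Qed.

Let cE : c = q ^- (2 * N). Proof. by rewrite exprM. Qed.

Let tbE : p * t / b = q ^- (2 * (a + N)).
Proof.
rewrite (_ : 2 * (3 * a + N + 2) = 2 * (a + N) + (2 + 2 * (2 * a + 1)))%N.
  by rewrite exprD exprD; field; rewrite ?qn ?q0.
by lia.
Qed.

Let tcE : p * t / c = q ^+ (2 * (2 * a + N + 2)).
Proof.
by rewrite invrK -exprM -!exprD; congr (_ ^+ _); lia.
Qed.

Let dd : d ^+ 2 = p * t.
Proof. by rewrite -exprM -exprD; congr (_ ^+ _); lia. Qed.

Let bc : b * c = t * d.
Proof.
rewrite cE (_ : 2 * (3 * a + N + 2) = 2 * (2 * a + 1) + 2 * (a + 1) + 2 * N)%N.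
  by rewrite exprD mulfK // exprD.
by lia.
Qed.

Lemma gamE r : gam q a r = twist p d r.
Proof.
rewrite /gam /twist (exprNn d) -mulrA -!exprM -exprD; congr (_ * _ ^+ _).
have E : (2 * 'C(r, 2) + r = r * r)%N.
  by elim: r => // r; rewrite binS bin1; lia.
by rewrite mulnDr mulnDr -E; lia.
Qed.

Lemma gam_neq0 r : gam q a r != 0.
Proof. by rewrite /gam mulf_neq0 // signr_eq0. Qed.

Lemma mqE : mq q a N = b ^+ N * (qpoch (p * t / b) p N / qpoch (p * t) p N).
Proof.
rewrite /mq tbE -exprM -exprD; congr (_ ^+ _ * (_ / qpoch (_ ^+ _) _ _)); lia.
Qed.

Lemma racah_qracah i j : (i <= N)%N -> (j <= N)%N ->
  racah q a N i j = qracah p t b c d N i j.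
Proof.
move=> lei lej; rewrite racahE //.
rewrite /qracah (@sum_widen _ (fun r =>
  racah_coef p b c d r * phi p t r i * phi p t r j) (minn i j)).
- apply: eq_bigr => k _.
  rewrite /racah_coef /phi /qpochs !big_cons !big_nil !mulr1 -!exprM.
  by rewrite !mulnDr !exprD !invfM; ring.
- by rewrite geq_min lei.
- move=> r; rewrite gtn_min => /orP[] lt.
    by rewrite (phi_vanish _ _ lt) ?mulr0 ?mul0r.
  by rewrite (phi_vanish _ _ lt) ?mulr0.
Qed.

Lemma beta2_omega j : (j <= N)%N ->
  beta2 q a N j = omega p t b c j * gam q a j.
Proof.
move=> lej; rewrite /beta2 /qpochs !big_cons !big_nil !mulr1.
have w1 : 1 - q ^+ (2 * a + 1) != 0 by rewrite addn1.
have w2 : 1 + q ^+ (2 * a + 1) != 0 by rewrite gt_eqF // addr_gt0 ?exprn_gt0.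
have -> : q ^+ (2 * a + 3) = q ^+ (2 * a + 1) * p.
  by rewrite -exprD; congr (_ ^+ _); lia.
have := qpoch_square p j w1 w2.
have -> : q ^+ (2 * a + 1) ^+ 2 = t by rewrite -exprM; congr (_ ^+ _); lia.
have : qpoch (q ^+ (2 * a + 1)) p j != 0.
  by apply: qpoch_neq0 => m _; rewrite qp1 // addn1.
have : qpoch (- q ^+ (2 * a + 1)) p j != 0.
  apply: qpoch_neq0 => m _; rewrite mulNr opprK gt_eqF //.
  by rewrite addr_gt0 // -exprM -exprD exprn_gt0.
rewrite /omega tbE tcE -cE bc gamE /twist.
have -> : - (t * d) = t * - d by rewrite mulrN.
rewrite (exprMn j t) (_ : q ^+ (2 * j * (2 * a + 1)) = t ^+ j); last first.
  by rewrite -exprM; congr (_ ^+ _); lia.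
have : t ^+ j != 0 by rewrite -exprM.
have : (- d) ^+ j != 0 by rewrite expf_neq0 // oppr_eq0.
have : p ^+ 'C(j, 2) != 0 by rewrite -exprM.
have : qpoch p p j != 0 by apply: qpoch_neq0 => m _; rewrite qp1.
have : qpoch (q ^- (2 * (a + N))) p j != 0.
  by apply: qpoch_neq0 => m lt; rewrite q1V; lia.
have : qpoch (q ^+ (2 * (2 * a + N + 2))) p j != 0.
  by apply: qpoch_neq0 => m _; rewrite qp1 //; lia.
move: (qpoch (_ * p) p j) (qpoch (- (_ * p)) p j) => A A'.
move: (qpoch (q ^+ (2 * a + 1)) p j) (qpoch (- _) p j) => B B'.
move: (qpoch t p j) (qpoch b p j) (qpoch c p j) (qpoch p p j)
  (qpoch (q ^- _) p j) (qpoch (q ^+ (2 * (2 * a + N + 2))) p j) => X Y Z P Q S.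
move: ((1 - _) / _) (t ^+ j) ((- d) ^+ j) (p ^+ 'C(j, 2)) => W T D C.
move=> S0 Q0 P0 C0 D0 T0 B'0 B0 E.
transitivity (A * A' * (X * Y * Z) / (T * (P * B * B' * Q * S))).
  by field; rewrite ?S0 ?Q0 ?P0 ?T0 ?B0 ?B'0.
by rewrite E; field; rewrite ?S0 ?Q0 ?P0 ?T0 ?B0 ?B'0 ?C0 ?D0.
Qed.

Lemma beta2_neq0 j : (j <= N)%N -> beta2 q a N j != 0.
Proof.
move=> lej; rewrite /beta2 /qpochs !big_cons !big_nil !mulr1.
have nn n k : (0 < n)%N -> qpoch (q ^+ n) p k != 0.
  by move=> n0; apply: qpoch_neq0 => m _; rewrite qp1.
have nm n k : qpoch (- q ^+ n) p k != 0.
  apply: qpoch_neq0 => m _; rewrite mulNr opprK gt_eqF //.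
  by rewrite addr_gt0 // -exprM -exprD exprn_gt0.
have nv n : (j <= n)%N -> qpoch (q ^- (2 * n)) p j != 0.
  by move=> le; apply: qpoch_neq0 => m lt; rewrite q1V //; lia.
by rewrite !(mulf_neq0, invr_neq0) ?nn ?nm ?nv ?qn //; lia.
Qed.

Lemma mq_neq0 : mq q a N != 0.
Proof.
rewrite /mq !(mulf_neq0, invr_neq0) ?qn //; apply: qpoch_neq0 => m lt.
  by rewrite q1V; lia.
by rewrite qp1; lia.
Qed.

Let p1 m : 1 - p ^+ m.+1 != 0. Proof. by rewrite exprS qp1. Qed.
Let t1 m : 1 - t * p ^+ m != 0. Proof. by rewrite qp1; lia. Qed.
Let b1 m : 1 - b * p ^+ m != 0. Proof. by rewrite qp1; lia. Qed.
Let d1 m : 1 - d * p ^+ m != 0. Proof. by rewrite qp1; lia. Qed.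
Let tb1 m : (m < N)%N -> 1 - p * t / b * p ^+ m != 0.
Proof. by move=> lt; rewrite tbE q1V; lia. Qed.

(** The (i, k) entry of the braid relation, stripped of the diagonal factors
    that both sides share. *)
Lemma racah_conv i k : (i <= N)%N -> (k <= N)%N ->
  mq q a N * \sum_(j < N.+1) racah q a N i j * (beta2 q a N j / gam q a j)
     * racah q a N j k
  = gam q a i * gam q a k * racah q a N i k.
Proof.
move=> lei lek.
transitivity (mq q a N * \sum_(j < N.+1)
  qracah p t b c d N i j * omega p t b c j * qracah p t b c d N j k).
  congr (_ * _); apply: eq_bigr => j _.
  have lej : (j <= N)%N := ltn_ord j.
  by rewrite !racah_qracah // beta2_omega // mulfK ?gam_neq0.
rewrite qracah_conv // mulrA mqE omega_sum // mul1r.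
by rewrite -!gamE -racah_qracah.
Qed.

(** The expansion of the q-Racah polynomials in the phi_r factors S_2 into
    invertible diagonal matrices, a lower triangular matrix with nonzero
    diagonal, and its transpose. *)
Lemma S2_unit : S2 q a N \in unitmx.
Proof.
pose A : 'M[R]_N.+1 := \matrix_(i, r) phi p t r i.
have -> : S2 q a N = diag_mx (\row_i (mq q a N / gam q a i)) *m A
   *m diag_mx (\row_r racah_coef p b c d r) *m A^T
   *m diag_mx (\row_j (beta2 q a N j / gam q a j)).
  apply/matrixP => i j; rewrite mul_mx_diag !mxE.
  rewrite racah_qracah ?leq_ord // /qracah !mulr_sumr mulr_suml.
  apply: eq_bigr => r _; rewrite mul_mx_diag mul_diag_mx !mxE.
  by ring.
have cn k : (k <= N)%N -> qpoch c p k != 0.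
  by move=> le; rewrite cE; apply: qpoch_neq0 => m lt; rewrite q1V; lia.
have uD (f : 'rV[R]_N.+1) : (forall i, f 0 i != 0) -> diag_mx f \in unitmx.
  by move=> f0; rewrite unitmxE det_diag unitfE; apply/prodf_neq0.
have uA : A \in unitmx.
  have trA : is_trig_mx A.
    by apply/is_trig_mxP => i j lt; rewrite mxE phi_vanish.
  rewrite unitmxE det_trig // unitfE; apply/prodf_neq0 => i _.
  rewrite mxE /phi mulf_neq0 //; apply: qpoch_neq0 => m lt.
    by rewrite -exprM q1V.
  by rewrite -exprM -exprD qp1; lia.
have coef_neq0 (r : 'I_N.+1) : racah_coef p b c d r != 0.
  rewrite /racah_coef mulf_neq0 ?(expf_neq0 _ (qn 2)) // invr_eq0.
  rewrite !mulf_neq0 ?cn ?leq_ord //; apply: qpoch_neq0 => // m _.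
  by rewrite qp1.
rewrite !unitmx_mul unitmx_tr uA /= !uD // => i; rewrite mxE ?coef_neq0 //.
  by rewrite mulf_neq0 ?invr_eq0 ?gam_neq0 ?beta2_neq0 // leq_ord.
by rewrite mulf_neq0 ?invr_eq0 ?gam_neq0 ?mq_neq0.
Qed.

Lemma braid_relation :
  S1 q a N *m S2 q a N *m S1 q a N = S2 q a N *m S1 q a N *m S2 q a N.
Proof.
apply/matrixP => i k; rewrite /S1 mul_mx_diag mul_diag_mx !mxE.
have gn r : gam q a r != 0 by exact: gam_neq0.
transitivity (mq q a N * beta2 q a N k * ((gam q a i)^-1 * (gam q a k)^-1 *
   (gam q a i * gam q a k * racah q a N i k))).
  by field; rewrite !gn.
rewrite -racah_conv ?leq_ord // !mulr_sumr; apply: eq_bigr => j _.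
rewrite mul_mx_diag !mxE.
by field; rewrite !gn.
Qed.

Lemma S1_unit : S1 q a N \in unitmx.
Proof.
rewrite unitmxE det_diag unitfE; apply/prodf_neq0 => i _.
by rewrite mxE gam_neq0.
Qed.
End Braid.

Theorem corollary3p1 (R : realType) (q : R) (s l : rat) (a N : nat)
  (hq0 : 0 < q) (hq1 : q < 1)
  (hs : is_spin s) (hl : Jset s l)
  (ha : a%:R = `|s - l|)
  (hN : N%:R = Num.min (2 * s) (s + l) - `|s - l|) :
  [/\ S1 q a N \in unitmx,
      S2 q a N \in unitmx
    & S1 q a N *m S2 q a N *m S1 q a N = S2 q a N *m S1 q a N *m S2 q a N].
Proof.
by split; [exact: S1_unit | exact: S2_unit | exact: braid_relation].
Qed.
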